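(* Let $S$ be a semigroup with zero. If $Z(S)=\mathrm{Nil}(S)\neq\{0\}$, then the zero-divisor digraph $\overrightarrow{\Gamma}(S)$ is connected. If moreover $|Z(S)^{*}|\geq 2$, then $\mathrm{Diam}(\overrightarrow{\Gamma}(S))\leq 2$.
   Context: Let $S$ be a semigroup with zero, not necessarily commutative; for $A\subseteq S$, $A^{*}=A\setminus\{0\}$. An element $x\in S$ is a left (resp. right) zero divisor if $xy=0$ (resp. $yx=0$) for some $y\in S^{*}$; $Z(S)$ is the set of all elements that are left or right zero divisors. $\mathrm{Nil}(S)$ is the set of nilpotent elements of $S$. The zero-divisor digraph $\overrightarrow{\Gamma}(S)$ is the simple digraph (no loops, no multiple arcs) with vertex set $Z(S)^{*}$ in which, for distinct $x,y\in Z(S)^{*}$, $x\to y$ is an arc if and only if $xy=0$. A digraph is connected if for every two distinct vertices $x,y$ there is a directed path from $x$ to $y$. The directed distance from $x$ to $y$ is the length of a shortest directed path from $x$ to $y$ ($\infty$ if none exists), and $\mathrm{Diam}$ is the greatest directed distance between vertices. *)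

(* Defs.v *)
From HB Require Import structures.
From mathcomp Require Import all_boot all_order all_algebra.
From mathcomp Require Import boolp classical_sets functions cardinality.
From mathcomp Require Import constructive_ereal.

Set Implicit Arguments.
Unset Strict Implicit.
Unset Printing Implicit Defensive.

Import Order.TTheory GRing.Theory Num.Theory.

Local Open Scope group_scope.
Local Open Scope classical_set_scope.

HB.mixin Record Semigroup_hasZero S of Semigroup S := {
  szero : S;
  mul0s : left_zero szero (fun x y : S => x * y);
  muls0 : right_zero szero (fun x y : S => x * y)
}.

#[short(type="semigroup0Type")]
HB.structure Definition Semigroup0 := {S of Semigroup S & Semigroup_hasZero S}.

Section ZeroDivisors.
Variable S : semigroup0Type.
Implicit Types (x y : S) (A : set S).

Definition star A : set S := A `\ szero.

Definition left_zdiv x := exists2 y, star setT y & x * y = szero.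
Definition right_zdiv x := exists2 y, star setT y & y * x = szero.
Definition zdiv : set S := [set x | left_zdiv x \/ right_zdiv x].

(* For n > 0, iterop n *%g x e is the product of n copies of x and does not
   depend on e: this is how MathComp defines x ^+ n when there is a unit. *)
Definition nilpotents : set S :=
  [set x | exists2 n, (0 < n)%N & iterop n *%g x szero = szero].

End ZeroDivisors.

Arguments zdiv : clear implicits.
Arguments nilpotents : clear implicits.

Record sdigraph (T : eqType) := SDigraph {
  vertices : set T;
  arc : rel T;
  arcW : forall x y, arc x y -> [/\ vertices x, vertices y & x != y]
}.

Section Digraph.
Variables (T : eqType) (G : sdigraph T).
Implicit Types (x y : T) (n : nat).

(* x :: p is the list of vertices of the path; its length is size p. *)
Definition dpath n x y := exists p : seq T,
  [/\ vertices G x, path (arc G) x p, last x p = y, uniq (x :: p) & size p = n].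

Definition dconnected := forall x y,
  vertices G x -> vertices G y -> x <> y -> exists n, dpath n x y.

(* Distances live in \bar int; infimum +oo sends the empty set to +oo. *)
Definition ddist x y : \bar int :=
  infimum +oo%E [set (n%:Z)%:E%E | n in [set n | dpath n x y]].

Definition diam : \bar int :=
  supremum 0%E
    [set d | exists x y, [/\ vertices G x, vertices G y & d = ddist x y]].

End Digraph.

Section ZeroDivisorDigraph.
Variable S : semigroup0Type.

Definition zd_arc : rel S := fun x y =>
  [&& x \in star (zdiv S), y \in star (zdiv S), x != y & x * y == szero].

Lemma zd_arcW x y : zd_arc x y ->
  [/\ star (zdiv S) x, star (zdiv S) y & x != y].
Proof. by case/and4P => /set_mem ? /set_mem ? ? _. Qed.

Definition zdgraph : sdigraph S := SDigraph zd_arcW.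

End ZeroDivisorDigraph.

Arguments zdgraph : clear implicits.

Section DistanceTheory.
Variables (T : eqType) (G : sdigraph T).

Lemma ddist_pinfty x y : ~ (exists n, dpath G n x y) -> ddist G x y = +oo%E.
Proof.
move=> nP; rewrite /ddist (_ : [set n | dpath G n x y] = set0).
  by rewrite image_set0 /infimum eqxx.
by apply/seteqP; split=> // n Pn; apply: nP; exists n.
Qed.

Lemma ddistP x y n : dpath G n x y ->
  (forall m, dpath G m x y -> (n <= m)%N) -> ddist G x y = (n%:Z)%:E%E.
Proof.
move=> Pn minn; rewrite /ddist /infimum ifF; last first.
  by apply/negbTE/set0P; exists (n%:Z)%:E%E; exists n.
set A := [set _ | _ in _].
have infA : infimums A (n%:Z)%:E%E.
  split; first by move=> _ [m Pm <-]; rewrite lee_fin lez_nat; apply: minn.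
  by move=> d; apply; exists n.
case: xgetP => [d _ dA|/(_ _ infA)//].
apply/le_anti/andP; split; [exact/infA.2/dA.1|exact/dA.2/infA.1].
Qed.

Lemma ddist_cases x y :
  (~ (exists n, dpath G n x y)) /\ ddist G x y = +oo%E \/
  exists n, [/\ dpath G n x y, forall m, dpath G m x y -> (n <= m)%N
               & ddist G x y = (n%:Z)%:E%E].
Proof.
have [exP|] := pselect (exists n, dpath G n x y); last first.
  by move=> nP; left; split=> //; exact: ddist_pinfty.
have exb : exists n, `[< dpath G n x y >] by case: exP => n /asboolP; exists n.
right; case: (ex_minnP exb) => n /asboolP Pn minn.
have {}minn m : dpath G m x y -> (n <= m)%N by move=> /asboolP /minn.
by exists n; split=> //; exact: ddistP.
Qed.

Lemma diamP x : vertices G x -> supremums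
  [set d | exists y z, [/\ vertices G y, vertices G z & d = ddist G y z]]
  (diam G).
Proof.
move=> Vx; rewrite /diam; set A := [set d | _].
have A0 : A !=set0 by exists (ddist G x x), x, x.
rewrite /supremum ifF; last exact/negbTE/set0P.
suff [d supA] : exists d, supremums A d by case: xgetP => [e _ //|/(_ d)].
have AE d : A d -> d = +oo%E \/ exists n : nat, d = (n%:Z)%:E%E.
  move=> [y [z [_ _ ->]]]; have [[_ ->]|[n [_ _ ->]]] := ddist_cases y z; first by left.
  by right; exists n.
have [exN|nexN] := pselect (exists n : nat, ubound A (n%:Z)%:E%E).
  have exb : exists n : nat, `[< ubound A (n%:Z)%:E%E >].
    by case: exN => n /asboolP; exists n.
  case: (ex_minnP exb) => n /asboolP An minn; exists (n%:Z)%:E%E; split=> // u Au.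
  have [d Ad] := A0; move: (Au _ Ad) (An _ Ad).
  have [->//|[m ->]] := AE _ Ad.
  case: u Au => [[k|k]||] //= Au _ _.
  by rewrite lee_fin lez_nat; apply: minn; apply/asboolP.
exists +oo%E; split=> [d _|u Au]; first exact: leey.
have [d Ad] := A0; move: (Au _ Ad).
have [->//|[m ->]] := AE _ Ad.
case: u Au => [[k|k]||] //= Au _.
by case: nexN; exists k.
Qed.

End DistanceTheory.

(* Main.v *)
Require Import Defs.
From mathcomp Require Import all_boot all_order all_algebra.
From mathcomp Require Import boolp classical_sets functions cardinality.
From mathcomp Require Import constructive_ereal.

(** Any two vertices [x] and [y] are annihilated from the two sides by a common
    nonzero element. Both are nilpotent, so starting from any nonzero [w] one
    can multiply by [x] on the left until one more factor would give zero, and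
    then by [y] on the right until one more factor would give zero. The result
    [z = x ^ i * w * y ^ j] is nonzero, [x * z = 0] and [z * y = 0] (lemma
    [nilpotent_annihilator]). For distinct [x] and [y], such a [z] is a
    vertex, so [x -> z -> y] is a path of length 2 unless [z] is [x] or [y]; in that case
    [x * y = 0] and [x -> y] is an arc. Hence all distances are at most 2. *)

Local Open Scope classical_set_scope.
Local Open Scope card_scope.

(** Going down from [n], the iterates cannot all be [e], since the one of
    index 0 is [w]. *)
Lemma iter_last_neq (T : eqType) (f : T -> T) (e w : T) n :
  w <> e -> iter n f w = e ->
  exists k, iter k f w <> e /\ f (iter k f w) = e.
Proof.
elim: n => [//|n IHn] w_neq /= fn_e.
by case: (eqVneq (iter n f w) e) => [/(IHn w_neq)//|/eqP]; exists n.
Qed.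

Section NilpotentAnnihilators.
Local Open Scope group_scope.
Variable S : semigroup0Type.
Implicit Types w x y z : S.

Lemma szero_nilpotent : nilpotents S szero.
Proof. by exists 1%N. Qed.

Lemma iter_mull x w n :
  iter n.+1 (fun u => x * u) w = iter n (fun u => x * u) x * w.
Proof. by elim: n => [//|n IHn]; rewrite iterS IHn /= mulgA. Qed.

Lemma iter_mulr x w n :
  iter n.+1 (fun u => u * x) w = w * iter n (fun u => x * u) x.
Proof. by elim: n w => [//|n IHn] w; rewrite iterSr IHn /= mulgA. Qed.

Lemma iter_mulr_shift x y z n :
  iter n (fun u => u * y) (x * z) = x * iter n (fun u => u * y) z.
Proof. by elim: n => [//|n /= ->]; rewrite mulgA. Qed.

Lemma iter_mulr0 y n : iter n (fun u : S => u * y) szero = szero.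
Proof. by elim: n => [//|n /= ->]; rewrite mul0s. Qed.

(** The element is [z = x ^ i * w * y ^ j], each exponent in turn being the
    largest for which the product stays nonzero. Already [x] kills
    [x ^ i * w], and right multiplication by [y] preserves this. *)
Lemma nilpotent_annihilator x y w :
  nilpotents S x -> nilpotents S y -> w <> szero ->
  exists z, [/\ z <> szero, x * z = szero & z * y = szero].
Proof.
move=> [[//|n] _ +] [[//|m] _ +] w_neq0; rewrite !iteropS => xn0 ym0.
have := @iter_last_neq _ (fun u => x * u) szero w n.+1 w_neq0.
rewrite iter_mull xn0 mul0s => -[//|i [v_neq0 xv0]].
set v := iter i _ w in v_neq0 xv0.
have := @iter_last_neq _ (fun u => u * y) szero v m.+1 v_neq0.
rewrite iter_mulr ym0 muls0 => -[//|j [z_neq0 zy0]].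
exists (iter j (fun u => u * y) v); split=> //.
by rewrite -iter_mulr_shift xv0 iter_mulr0.
Qed.

Lemma zd_arcI x y : star (zdiv S) x -> star (zdiv S) y -> x <> y ->
  x * y = szero -> zd_arc x y.
Proof.
by move=> xZ yZ /eqP xy /eqP xy0; apply/and4P; split=> //; apply/mem_set.
Qed.

Lemma zdgraph_dpath_le2 x y : zdiv S `<=` nilpotents S ->
  vertices (zdgraph S) x -> vertices (zdgraph S) y ->
  exists n, (n <= 2)%N /\ dpath (zdgraph S) n x y.
Proof.
move=> ZNil xV yV; have [xZ x_neq0] := xV; have [yZ _] := yV.
have [<-|/eqP x_neq_y] := eqVneq x y; first by exists 0%N; split=> //; exists [::].
have [xy0|/eqP xy_neq0] := eqVneq (x * y) szero.
  exists 1%N; split=> //; exists [:: y]; split=> //=.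
    by rewrite andbT; exact: zd_arcI.
  by rewrite inE andbT; apply/eqP.
have [z [z_neq0 xz0 zy0]] :=
  nilpotent_annihilator x y x (ZNil _ xZ) (ZNil _ yZ) x_neq0.
have zV : star (zdiv S) z by split=> //; right; exists x.
have x_neq_z : x <> z by move=> xz; apply: xy_neq0; rewrite xz.
have z_neq_y : z <> y by move=> zy; apply: xy_neq0; rewrite -zy.
exists 2%N; split=> //; exists [:: z; y]; split=> //=.
  by rewrite !zd_arcI.
by rewrite !inE andbT negb_or; apply/andP; split; [apply/andP; split|];
  apply/eqP.
Qed.

End NilpotentAnnihilators.

Lemma ddist_le (T : eqType) (G : sdigraph T) (x y : T) m n :
  dpath G m x y -> (m <= n)%N -> (ddist G x y <= (n%:Z)%:E)%E.
Proof.
move=> Pm le_mn; have [[[]]|[k [_ mink ->]]] := ddist_cases G x y.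
  by exists m.
by rewrite lee_fin; apply: leq_trans le_mn; exact: mink.
Qed.

Theorem corollary3p2 (S : semigroup0Type)
    (ZNil : zdiv S = nilpotents S) (Nil_neq0 : nilpotents S <> [set szero]) :
  dconnected (zdgraph S) /\
  (`I_2 #<= star (zdiv S) -> (diam (zdgraph S) <= 2%:E)%E).
Proof.
have ZsubNil : zdiv S `<=` nilpotents S by rewrite ZNil.
split=> [x y xV yV _|_].
  by have [n [_ ?]] := zdgraph_dpath_le2 _ _ _ ZsubNil xV yV; exists n.
(* The diameter is a genuine supremum only if there is a vertex: here a
   nonzero nilpotent, which exists because [szero] is always nilpotent. *)
have [x xV] : exists x, vertices (zdgraph S) x.
  apply: contrapT => noV; apply: Nil_neq0; apply/seteqP; split=> [x xN|_ ->].
    by apply: contrapT => x0; apply: noV; exists x; split; rewrite ?ZNil.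
  exact: szero_nilpotent.
apply: (diamP xV).2 => _ [y [z [yV zV ->]]].
have [n [le_n2 Pn]] := zdgraph_dpath_le2 _ _ _ ZsubNil yV zV.
exact: ddist_le Pn le_n2.
Qed.
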